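(* Let $\mathcal W$ be a measure matrix with moment matrix $G_{\mathcal W}$, and let $G_{\mathcal W}(t)=W_{1,0}(t_1)\,G_{\mathcal W}\,[W_{2,0}(t_2)]^{-1}$ be its time deformation, assumed to be well defined, differentiable term by term in the times, and to admit a factorization $G_{\mathcal W}(t)=S_1(t)^{-1}S_2(t)$ with $S_1(t)$ lower unitriangular and $S_2(t)$ invertible upper triangular. Then the Lax operators $L_1=S_1\Lambda S_1^{-1}$, $L_2=S_2\Lambda^\top S_2^{-1}$ satisfy, for all integers $j,r\ge1$, the Lax equations $$\frac{\partial L_1^j}{\partial t_{1,r}}=[(L_1^r)_+,L_1^j],\qquad \frac{\partial L_1^j}{\partial t_{2,r}}=[(L_2^r)_-,L_1^j],$$ $$\frac{\partial L_2^j}{\partial t_{1,r}}=[(L_1^r)_+,L_2^j],\qquad \frac{\partial L_2^j}{\partial t_{2,r}}=[(L_2^r)_-,L_2^j].$$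
   Context: Semi-infinite matrices are indexed from $0$. A measure matrix of order $\mathcal N$ is a semi-infinite matrix $\mathcal W=(d\mu_{i,j})$ of (possibly signed) Borel measures on sets $\Omega_{i,j}\subseteq\mathbb R$, zero if $i>\mathcal N$ or $j>\mathcal N$; $(f,h;\mathcal W)=\sum_{n,r}\int_{\Omega_{n,r}}f^{(n)}h^{(r)}d\mu_{n,r}$ (finite on polynomials) and $(G_{\mathcal W})_{n,p}=(x^n,x^p;\mathcal W)$. $\Lambda_{i,j}=\delta_{i+1,j}$. Times: $t_a=(t_{a,0}=0,t_{a,1},t_{a,2},\dots)$, $a=1,2$, real; $W_{1,0}(t_1)=\exp\big(\sum_jt_{1,j}\Lambda^j\big)$, $W_{2,0}(t_2)=\exp\big(\sum_jt_{2,j}(\Lambda^\top)^j\big)$. Thus $\partial G_{\mathcal W}(t)/\partial t_{1,j}=\Lambda^jG_{\mathcal W}(t)$ and $\partial G_{\mathcal W}(t)/\partial t_{2,j}=-G_{\mathcal W}(t)(\Lambda^\top)^j$. $(A)_-$ is the strictly lower triangular part of $A$ and $(A)_+$ its upper triangular part (including the diagonal); $[A,B]=AB-BA$. *)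

(* Defs.v *)
From mathcomp Require Export all_boot all_order all_algebra.
From mathcomp Require Export all_classical all_reals all_analysis.
Export Order.TTheory GRing.Theory Num.Theory.
Export numFieldNormedType.Exports.

#[export] Set Implicit Arguments.
#[export] Unset Strict Implicit.
#[export] Unset Printing Implicit Defensive.

#[global] Open Scope classical_set_scope.
#[global] Open Scope ring_scope.

Definition simx (R : realType) : Type := nat -> nat -> R.

Definition si1 (R : realType) : simx R := fun i j => (i == j)%:R.

Definition Lambda (R : realType) : simx R := fun i j => (i.+1 == j)%:R.

Definition sitr (R : realType) (A : simx R) : simx R := fun i j => A j i.

(* Entries of a product are series: [simul] is total, with the value of [limn]
   on a divergent series being meaningless, so convergence is recorded
   separately by [mulable]. *)
Definition mulable (R : realType) (A B : simx R) : Prop :=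
  forall i j, cvgn (series (fun k => A i k * B k j)).

Definition simul (R : realType) (A B : simx R) : simx R :=
  fun i j => limn (series (fun k => A i k * B k j)).

Definition sipow (R : realType) (A : simx R) (n : nat) : simx R :=
  iter n (simul A) (@si1 R).

Definition is_siinv (R : realType) (A B : simx R) : Prop :=
  [/\ mulable A B, simul A B = @si1 R, mulable B A & simul B A = @si1 R].

Definition siinvertible (R : realType) (A : simx R) : Prop :=
  exists B, is_siinv A B.

(* The default [A] is returned when [A] has no two-sided inverse.  The
   inverse is unique when [A] is upper or lower triangular. *)
Definition siinv (R : realType) (A : simx R) : simx R :=
  xget (A : nat -> nat -> R) [set B | is_siinv A B].

Definition sicomm (R : realType) (A B : simx R) : simx R :=
  fun i j => simul A B i j - simul B A i j.

Definition strict_lower_part (R : realType) (A : simx R) : simx R :=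
  fun i j => if (j < i)%N then A i j else 0.

Definition upper_part (R : realType) (A : simx R) : simx R :=
  fun i j => if (i <= j)%N then A i j else 0.

Definition lower_unitriangular (R : realType) (A : simx R) : Prop :=
  (forall i, A i i = 1) /\ (forall i j, (i < j)%N -> A i j = 0).

Definition upper_triangular (R : realType) (A : simx R) : Prop :=
  forall i j, (j < i)%N -> A i j = 0.

(* Exponential series, entrywise; its entries are finite sums when [A] is
   strictly upper or strictly lower triangular. *)
Definition siexp (R : realType) (A : simx R) : simx R :=
  fun i j => limn (series (fun n => (n`!%:R)^-1 * sipow A n i j)).

(* [\sum_k u k A ^ k], entrywise. *)
Definition sipowseries (R : realType) (u : nat -> R) (A : simx R) : simx R :=
  fun i j => limn (series (fun k => u k * sipow A k i j)).

Lemma hahn_pair (R : realType)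
    (nu : {charge set (measurableTypeR R) -> \bar R}) :
  exists PN : set (measurableTypeR R) * set (measurableTypeR R),
    hahn_decomposition nu PN.1 PN.2.
Proof. by have [P [N PN]] := Hahn_decomposition nu; exists (P, N). Qed.

(* The Jordan decomposition does not depend on the chosen Hahn
   decomposition. *)
Definition pos_part (R : realType)
    (nu : {charge set (measurableTypeR R) -> \bar R}) :=
  jordan_pos (projT2 (cid (hahn_pair nu))).

Definition neg_part (R : realType)
    (nu : {charge set (measurableTypeR R) -> \bar R}) :=
  jordan_neg (projT2 (cid (hahn_pair nu))).

Definition charge_integrable (R : realType)
    (nu : {charge set (measurableTypeR R) -> \bar R})
    (D : set (measurableTypeR R)) (f : R -> R) : Prop :=
  (pos_part nu).-integrable D (EFin \o f) /\
  (neg_part nu).-integrable D (EFin \o f).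

Definition charge_integral (R : realType)
    (nu : {charge set (measurableTypeR R) -> \bar R})
    (D : set (measurableTypeR R)) (f : R -> R) : R :=
  Rintegral (pos_part nu) D f - Rintegral (neg_part nu) D f.

(* A signed Borel measure for which the constants are integrable is finite,
   hence is a charge.  A measure on the Borel sets of [Omega] is represented by
   a charge on the line, of which only the restriction to [Omega] is used. *)
Record measure_matrix (R : realType) (N : nat) := MeasureMatrix {
  mm_set : nat -> nat -> set (measurableTypeR R);
  mm_charge : nat -> nat -> {charge set (measurableTypeR R) -> \bar R};
  mm_measurable : forall i j, measurable (mm_set i j);
  mm_order : forall i j, (N < i)%N || (N < j)%N ->
    forall A, measurable A -> A `<=` mm_set i j -> mm_charge i j A = 0%E;
  mm_integrable : forall i j (p : {poly R}),
    charge_integrable (mm_charge i j) (mm_set i j) (horner p)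
}.

(* The sum over all derivatives stops at the order [N], beyond which the
   measures vanish. *)
Definition mm_form (R : realType) (N : nat) (W : measure_matrix R N)
    (f h : {poly R}) : R :=
  \sum_(n < N.+1) \sum_(r < N.+1)
    charge_integral (mm_charge W n r) (mm_set W n r)
      (fun x => (f^`(n)).[x] * (h^`(r)).[x]).

Definition moment_matrix (R : realType) (N : nat) (W : measure_matrix R N) :
    simx R :=
  fun n p => mm_form W 'X^n 'X^p.

(* [t.1 j] is t_{1,j} and [t.2 j] is t_{2,j}. *)
Definition times (R : realType) : Type := ((nat -> R) * (nat -> R))%type.

Definition set_t1 (R : realType) (t : times R) (r : nat) (x : R) : times R :=
  ((fun k => if k == r then x else t.1 k), t.2).

Definition set_t2 (R : realType) (t : times R) (r : nat) (x : R) : times R :=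
  (t.1, (fun k => if k == r then x else t.2 k)).

(* A set of times on which all partial derivatives make sense.  The infinite
   series defining the deformation cannot be expected to converge for every
   pair of real sequences. *)
Definition time_domain (R : realType) (D : set (times R)) : Prop :=
  forall t, D t ->
    [/\ t.1 0%N = 0, t.2 0%N = 0 &
        forall r, (0 < r)%N ->
          (\forall x \near t.1 r, D (set_t1 t r x)) /\
          (\forall x \near t.2 r, D (set_t2 t r x))].

Definition is_partial1 (R : realType) (r : nat) (F : times R -> simx R)
    (t : times R) (dF : simx R) : Prop :=
  forall n p, is_derive (t.1 r) (1 : R) (fun x : R => F (set_t1 t r x) n p)
    (dF n p).

Definition is_partial2 (R : realType) (r : nat) (F : times R -> simx R)
    (t : times R) (dF : simx R) : Prop :=
  forall n p, is_derive (t.2 r) (1 : R) (fun x : R => F (set_t2 t r x) n p)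
    (dF n p).

Definition W10 (R : realType) (u : nat -> R) : simx R :=
  siexp (sipowseries u (@Lambda R)).

Definition W20 (R : realType) (u : nat -> R) : simx R :=
  siexp (sipowseries u (sitr (@Lambda R))).

Definition deformation (R : realType) (G : simx R) (t : times R) : simx R :=
  simul (simul (W10 t.1) G) (siinv (W20 t.2)).

Definition deformation_defined (R : realType) (G : simx R) (t : times R) :
    Prop :=
  mulable (W10 t.1) G /\ mulable (simul (W10 t.1) G) (siinv (W20 t.2)).

(* The general term of the double series, over [l] and [k], which gives the
   entry (n, p) of the deformation. *)
Definition deformation_term (R : realType) (G : simx R) (n p l k : nat)
    (t : times R) : R :=
  W10 t.1 n k * G k l * siinv (W20 t.2) l p.

(* Along the curve [c], at [x], the entries of the deformation are
   differentiable, with derivatives the convergent (iterated) double series of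
   the derivatives of the terms. *)
Definition termwise_derivable (R : realType) (G : simx R)
    (c : R -> times R) (x : R) : Prop :=
  forall n p, exists dT : nat -> nat -> R,
    [/\ forall l k,
          is_derive x (1 : R) (fun y : R => deformation_term G n p l k (c y))
            (dT l k),
        forall l, cvgn (series (dT l)),
        cvgn (series (fun l => limn (series (dT l)))) &
        is_derive x (1 : R) (fun y : R => deformation G (c y) n p)
          (limn (series (fun l => limn (series (dT l)))))].

Definition deformation_termwise_derivable (R : realType) (G : simx R)
    (t : times R) : Prop :=
  forall r, (0 < r)%N ->
    termwise_derivable G (set_t1 t r) (t.1 r) /\
    termwise_derivable G (set_t2 t r) (t.2 r).

Definition Lax1 (R : realType) (S1 : simx R) : simx R :=
  simul (simul S1 (@Lambda R)) (siinv S1).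

Definition Lax2 (R : realType) (S2 : simx R) : simx R :=
  simul (simul S2 (sitr (@Lambda R))) (siinv S2).

(* Main.v *)
Require Import Defs.
From mathcomp Require Import zify.

(** Write [G] for the deformed moment matrix, [M] and [Q] for the inverses of
   [S1] and [S2].  Along the line of the time [t_{1,r}] the termwise derivative
   of the defining double series is [G' = Lambda ^ r G], and along the line of
   [t_{2,r}] it is [G' = - G (Lambda^T) ^ r] ([deformation_derive1] and
   [deformation_derive2]); this rests on the derivatives of the exponentials and
   on the fact that their exponents commute with the shifts.

   The factors [S1] and [S2] are not assumed to be differentiable, but Gaussian
   elimination expresses their entries rationally in those of [G], with nonzero
   pivots, so they are ([LU_derivable], [factors_derivable]).  Differentiating
   [S1 G = S2] then gives [S2' Q = S1' M + Z] with [Z = S1 G' Q].  Since [S2' Q]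
   is upper triangular and [S1' M] strictly lower triangular, they are the upper
   part of [Z] and minus its strictly lower part ([factors_derive]).  From
   [G = M S2], [Z] is [L1 ^ r] in the first case and [- L2 ^ r] in the second.

   Finally [L1 ^ j = S1 Lambda ^ j M] and [L2 ^ j = S2 (Lambda^T) ^ j Q], and a
   conjugate [P X P^-1] of a constant matrix has as derivative its commutator with
   [P' P^-1] ([is_mxderive_conj]).  This gives the four equations, up to
   exchanging the two triangular parts of [Z] when [Z] commutes with the power
   that is differentiated ([sicommN_commute]).

   All products are infinite sums, for which associativity fails in general.
   It holds here because [S1], [M] and [L1] have finite rows with a uniform
   bound, and [S2], [Q] and [L2] finite columns: a product of three matrices is
   associative when the first two have finite rows, when the last two have
   finite columns, or when the first has finite rows and the last finite columns
   ([simulAl], [simulAr], [simulAm]).  The last case allows any matrix, such as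
   [G], in the middle. *)

Local Notation "A ** B" := (simul A B) (at level 40, left associativity).

(** * Products of banded semi-infinite matrices *)

Lemma cvg_series_finite (R : realType) (u : nat -> R) n :
  (forall k, (n <= k)%N -> u k = 0) -> series u @ \oo --> \sum_(k < n) u k.
Proof.
move=> u0; apply: cvg_near_cst; exists n => //= m /= nm.
rewrite -(big_mkord xpredT) /series /= (big_cat_nat (n := n) (p := m)) //=.
rewrite [X in _ + X]big_nat_cond [X in _ + X]big1 ?addr0 // => k.
by case/andP=> /andP[nk _] _; exact: u0.
Qed.

Lemma limn_series_finite (R : realType) (u : nat -> R) n :
  (forall k, (n <= k)%N -> u k = 0) -> limn (series u) = \sum_(k < n) u k.
Proof. by move=> /cvg_series_finite/cvg_lim; apply. Qed.

Lemma simul_finite (R : realType) (A B : simx R) n i j :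
  (forall k, (n <= k)%N -> A i k * B k j = 0) ->
  (A ** B) i j = \sum_(k < n) A i k * B k j.
Proof. exact: limn_series_finite. Qed.

(** A semi-infinite matrix whose entries beyond the [a]-th superdiagonal vanish,
   or beyond the [a]-th subdiagonal when [lower] is false.  The first kind has
   finite rows, with a uniform bound, and the second finite columns.  Both
   kinds are carried by one predicate because the argument treats the two Lax
   operators in the same way, one on each side. *)
Definition band (R : realType) (lower : bool) (a : nat) (A : simx R) : Prop :=
  forall i j, (if lower then i + a < j else j + a < i)%N -> A i j = 0.

Lemma sitrK (R : realType) : involutive (@sitr R).
Proof. by []. Qed.

(** Holds for all matrices, as the two entries are limits of the same series.
   This is what transports each result on lower banded matrices to upper
   banded ones, with the factors reversed. *)
Lemma sitrM (R : realType) (A B : simx R) : sitr (A ** B) = sitr B ** sitr A.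
Proof.
apply/funext => i; apply/funext => j; rewrite /sitr /simul.
by congr (limn (series _)); apply/funext => k; rewrite mulrC.
Qed.

Lemma sitr1 (R : realType) : sitr (@si1 R) = @si1 R.
Proof. by apply/funext => i; apply/funext => j; rewrite /sitr /si1 eq_sym. Qed.

Lemma band_tr (R : realType) s a (A : simx R) :
  band s a A -> band (~~ s) a (sitr A).
Proof. by move=> hA i j; case: s hA => hA /= ij; apply: hA. Qed.

Lemma sitrB (R : realType) (A B : simx R) : sitr (A - B) = sitr A - sitr B.
Proof. by []. Qed.

Lemma sitrD (R : realType) (A B : simx R) : sitr (A + B) = sitr A + sitr B.
Proof. by []. Qed.

Lemma sitrN (R : realType) (A : simx R) : sitr (- A) = - sitr A.
Proof. by []. Qed.

Lemma simul_lowerE (R : realType) a n (A B : simx R) i j :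
  band true a A -> (i + a < n)%N -> (A ** B) i j = \sum_(k < n) A i k * B k j.
Proof.
by move=> hA n_gt; apply: simul_finite => k nk; rewrite hA ?mul0r //=; lia.
Qed.

Lemma simul_upperE (R : realType) a n (A B : simx R) i j :
  band false a B -> (j + a < n)%N -> (A ** B) i j = \sum_(k < n) A i k * B k j.
Proof.
by move=> hB n_gt; apply: simul_finite => k nk; rewrite hB ?mulr0 //=; lia.
Qed.

Lemma band_mul (R : realType) s a b (A B : simx R) :
  band s a A -> band s b B -> band s (a + b) (A ** B).
Proof.
have lower a' b' (A' B' : simx R) :
    band true a' A' -> band true b' B' -> band true (a' + b') (A' ** B').
  move=> hA hB i j /= ij.
  rewrite (simul_lowerE (n := (i + a').+1) _ _ hA)//.
  by apply: big1 => k _; rewrite hB ?mulr0 //=; have := ltn_ord k; lia.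
case: s => hA hB; first exact: lower.
rewrite -[A ** B]sitrK sitrM addnC; apply: (@band_tr R true).
by apply: lower; exact: (@band_tr R false).
Qed.

Lemma band1 (R : realType) s : band s 0 (@si1 R).
Proof. by move=> i j; rewrite /si1; case: s; case: eqVneq => //; lia. Qed.

Lemma simul1l (R : realType) (A : simx R) : @si1 R ** A = A.
Proof.
apply/funext => i; apply/funext => j.
rewrite (simul_lowerE (n := i.+1) _ _ (@band1 R true)) ?addn0//.
rewrite (bigD1 ord_max) //= big1 ?addr0 => [|k]; rewrite /si1 ?eqxx ?mul1r //.
by rewrite -val_eqE /= eq_sym => /negbTE->; rewrite mul0r.
Qed.

Lemma simul1r (R : realType) (A : simx R) : A ** @si1 R = A.
Proof. by rewrite -[LHS]sitrK sitrM sitr1 simul1l. Qed.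

(** A sufficient condition for the total function [simul] to be an honest product
   at [A] and [B], and so to behave additively there. *)
Definition finite_product (R : realType) (A B : simx R) : Prop :=
  forall i j, exists n, forall k, (n <= k)%N -> A i k * B k j = 0.

Lemma finite_productl (R : realType) a (A B : simx R) :
  band true a A -> finite_product A B.
Proof. by move=> hA i j; exists (i + a).+1 => k ik; rewrite hA ?mul0r. Qed.

Lemma finite_productr (R : realType) b (A B : simx R) :
  band false b B -> finite_product A B.
Proof. by move=> hB i j; exists (j + b).+1 => k jk; rewrite hB ?mulr0. Qed.

Lemma band_finite_product (R : realType) s a b (A B : simx R) :
  band s a A -> band s b B -> finite_product A B.
Proof.
by case: s => hA hB; [exact: finite_productl hA | exact: finite_productr hB].
Qed.

Lemma simulBl (R : realType) (A A' B : simx R) :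
  finite_product A B -> finite_product A' B ->
  (A - A') ** B = A ** B - A' ** B.
Proof.
move=> fAB fA'B; apply/funext => i; apply/funext => j.
have [n hn] := fAB i j; have [n' hn'] := fA'B i j.
rewrite -[RHS]/((A ** B) i j - (A' ** B) i j).
rewrite !(simul_finite (n := maxn n n')) => [|k|k|k]; rewrite ?geq_max.
- by rewrite -sumrB; apply: eq_bigr => k _; rewrite -mulrBl.
- by move=> /andP[_ /hn'].
- by move=> /andP[/hn].
- move=> /andP[/hn e /hn' e']; rewrite -[LHS]/((A i k - A' i k) * B k j).
  by rewrite mulrBl e e' subrr.
Qed.

Lemma finite_product0l (R : realType) (B : simx R) : finite_product 0 B.
Proof. by move=> i j; exists 0%N => k _; rewrite mul0r. Qed.

Lemma simul0l (R : realType) (B : simx R) : 0 ** B = 0.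
Proof.
have f0 := finite_product0l B.
by have := simulBl f0 f0; rewrite !subrr.
Qed.

Lemma simulNl (R : realType) (A B : simx R) :
  finite_product A B -> (- A) ** B = - (A ** B).
Proof.
move=> fAB; rewrite -sub0r simulBl//; last exact: finite_product0l.
by rewrite simul0l sub0r.
Qed.

Lemma finite_productN (R : realType) (A B : simx R) :
  finite_product A B -> finite_product (- A) B.
Proof.
move=> fAB i j; have [n hn] := fAB i j; exists n => k nk.
by rewrite -[LHS]/(- A i k * B k j) mulNr hn ?oppr0.
Qed.

Lemma simulDl (R : realType) (A A' B : simx R) :
  finite_product A B -> finite_product A' B ->
  (A + A') ** B = A ** B + A' ** B.
Proof.
move=> fAB fA'B; rewrite -[A' in LHS]opprK simulBl//.
  by rewrite simulNl// opprK.
exact: finite_productN.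
Qed.

Lemma finite_product_tr (R : realType) (A B : simx R) :
  finite_product A B -> finite_product (sitr B) (sitr A).
Proof.
by move=> fAB i j; have [n hn] := fAB j i; exists n => k /hn; rewrite mulrC.
Qed.

Lemma simulBr (R : realType) (A B B' : simx R) :
  finite_product A B -> finite_product A B' ->
  A ** (B - B') = A ** B - A ** B'.
Proof.
move=> /finite_product_tr fAB /finite_product_tr fAB'.
apply: (can_inj (@sitrK R)); rewrite sitrM (sitrB B) simulBl//.
by rewrite (sitrB (A ** B)) !sitrM.
Qed.

Lemma simulNr (R : realType) (A B : simx R) :
  finite_product A B -> A ** (- B) = - (A ** B).
Proof.
move=> /finite_product_tr fAB; apply: (can_inj (@sitrK R)).
by rewrite sitrM (sitrN B) simulNl// (sitrN (A ** B)) sitrM.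
Qed.

(** Row [i] of a lower banded [A] is finite, so that the double series for an
   entry of [A ** B ** C] can be exchanged as soon as the sums over the other
   index are finite. *)
Lemma simulA_finite (R : realType) a (A B C : simx R) :
  band true a A -> finite_product B C -> A ** (B ** C) = A ** B ** C.
Proof.
move=> hA fBC; apply/funext => i; apply/funext => j.
pose n := (i + a).+1.
(* A bound for the sums over [l] that serves the finitely many [k] at once. *)
have [m hm] : exists m, forall k l,
    (k < n)%N -> (m <= l)%N -> B k l * C l j = 0.
  elim: n => [|n [m hm]]; first by exists 0%N.
  have [m' hm'] := fBC n j; exists (maxn m m') => k l.
  rewrite ltnS leq_eqVlt geq_max => /orP[/eqP-> /andP[_ /hm']//|kn /andP[ml _]].
  exact: hm.
rewrite (simul_lowerE (n := n) _ _ hA)// (simul_finite (n := m)) => [|l ml].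
  under eq_bigr => k _.
    rewrite (simul_finite (n := m)) => [|l ml]; last exact: hm.
    rewrite mulr_sumr; over.
  rewrite exchange_big; apply: eq_bigr => l _ /=.
  rewrite (simul_lowerE (n := n) _ _ hA)// mulr_suml.
  by apply: eq_bigr => k _; rewrite mulrA.
rewrite (simul_lowerE (n := n) _ _ hA)// mulr_suml big1// => k _.
by rewrite -mulrA hm ?mulr0.
Qed.

Lemma simulAl (R : realType) a b (A B C : simx R) :
  band true a A -> band true b B -> A ** (B ** C) = A ** B ** C.
Proof.
by move=> hA hB; apply: (simulA_finite hA); exact: finite_productl hB.
Qed.

Lemma simulAr (R : realType) b c (A B C : simx R) :
  band false b B -> band false c C -> A ** (B ** C) = A ** B ** C.
Proof.
move=> hB hC; apply: (can_inj (@sitrK R)); rewrite !sitrM.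
by rewrite (simulAl _ (band_tr hC) (band_tr hB)).
Qed.

Lemma simulAm (R : realType) a c (A B C : simx R) :
  band true a A -> band false c C -> A ** (B ** C) = A ** B ** C.
Proof.
by move=> hA hC; apply: (simulA_finite hA); exact: finite_productr hC.
Qed.

Lemma simulA (R : realType) s a b c (A B C : simx R) :
  band s a A -> band s b B -> band s c C -> A ** (B ** C) = A ** B ** C.
Proof.
case: s => hA hB hC; first exact: simulAl hA hB.
exact: simulAr hB hC.
Qed.

(** * Powers, shifts and triangular inverses *)

Lemma band_sipow (R : realType) s a (A : simx R) n :
  band s a A -> band s (n * a) (sipow A n).
Proof.
by move=> hA; elim: n => [|n IH]; [exact: band1 | exact: band_mul hA IH].
Qed.

Lemma sipowD (R : realType) s a (A : simx R) m n :
  band s a A -> sipow A m ** sipow A n = sipow A (m + n).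
Proof.
move=> hA; elim: m => [|m IH]; first exact: simul1l.
rewrite -[sipow A (m.+1 + n)]/(A ** sipow A (m + n)) -IH.
by rewrite (simulA hA (band_sipow hA) (band_sipow hA)).
Qed.

Lemma sipow_tr (R : realType) s a (A : simx R) n :
  band s a A -> sipow (sitr A) n = sitr (sipow A n).
Proof.
move=> hA; elim: n => [|n IH]; first by rewrite /= sitr1.
rewrite -[LHS]/(sitr A ** sipow (sitr A) n) IH -sitrM.
rewrite -[X in _ ** X]simul1r -[A ** si1 R]/(sipow A 1).
by rewrite (sipowD n 1 hA) addn1.
Qed.

Lemma sipow_conj (R : realType) s p q a (P Q X : simx R) n :
  band s p P -> band s q Q -> band s a X ->
  P ** Q = @si1 R -> Q ** P = @si1 R ->
  sipow (P ** X ** Q) n = P ** sipow X n ** Q.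
Proof.
move=> hP hQ hX PQ QP; elim: n => [|n IH]; first by rewrite /= simul1r.
have hXn := band_sipow (n := n) hX; have hPX := band_mul hP hX.
rewrite -[LHS]/((P ** X ** Q) ** sipow (P ** X ** Q) n) IH.
rewrite -(simulA hPX hQ (band_mul (band_mul hP hXn) hQ)).
rewrite (simulA hQ (band_mul hP hXn) hQ) (simulA hQ hP hXn) QP simul1l.
by rewrite (simulA hPX hXn hQ) -(simulA hP hX hXn).
Qed.

Lemma band_Lambda (R : realType) : band true 1 (@Lambda R).
Proof. by move=> i j /= ij; rewrite /Lambda; case: eqP => //; lia. Qed.

(** [Lambda] and its transpose only shift rows and columns, so that products
   with them make sense for every matrix, banded or not. *)
Lemma Lambda_simul (R : realType) (A : simx R) r i j :
  (sipow (@Lambda R) r ** A) i j = A (i + r)%N j.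
Proof.
have LA (B : simx R) i' j' : (@Lambda R ** B) i' j' = B i'.+1 j'.
  rewrite (simul_lowerE (n := i'.+2) _ _ (@band_Lambda R)) ?addn1//.
  rewrite big_ord_recr /= big1 ?add0r => [|k _]; rewrite /Lambda ?eqxx ?mul1r//.
  by rewrite eq_sym ltn_eqF ?mul0r// ltn_ord.
elim: r i => [|r IH] i; first by rewrite simul1l addn0.
rewrite -[sipow _ _]/(@Lambda R ** sipow (@Lambda R) r).
rewrite -(simulAl _ (@band_Lambda R) (band_sipow (@band_Lambda R))).
by rewrite LA IH addSnnS.
Qed.

Lemma simul_trLambda (R : realType) (A : simx R) r i j :
  (A ** sipow (sitr (@Lambda R)) r) i j = A i (j + r)%N.
Proof.
rewrite (sipow_tr r (@band_Lambda R)) -[_ ** _]sitrK sitrM sitrK /sitr.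
exact: (Lambda_simul (sitr A)).
Qed.

Lemma sipow_LambdaE (R : realType) r i j :
  sipow (@Lambda R) r i j = (i + r == j)%N%:R.
Proof. by rewrite -[sipow _ _]simul1r Lambda_simul. Qed.

Lemma simul_lower_recr (R : realType) (A B : simx R) i j : band true 0 A ->
  (A ** B) i j = \sum_(k < i) A i k * B k j + A i i * B i j.
Proof.
by move=> hA; rewrite (simul_lowerE (n := i.+1) _ _ hA) ?addn0// big_ord_recr.
Qed.

(** Forward substitution: row [i] of [A ** B = 1] gives row [i] of [B] from the
   previous ones, and its diagonal entry shows that the pivot [A i i] is
   nonzero. *)
Lemma lower_inverse (R : realType) (A B : simx R) :
  band true 0 A -> A ** B = @si1 R ->
  band true 0 B /\ forall i, A i i * B i i = 1.
Proof.
move=> hA AB.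
have H i : A i i * B i i = 1 /\ forall j, (i < j)%N -> B i j = 0.
  elim/ltn_ind: i => i IH.
  have row j : (i <= j)%N -> A i i * B i j = (i == j)%:R.
    move=> ij; have := congr1 (fun C : simx R => C i j) AB.
    rewrite simul_lower_recr// big1 ?add0r// => k _.
    by have [_ ->] := IH _ (ltn_ord k); rewrite ?mulr0//; exact: leq_trans ij.
  have Aii : A i i * B i i = 1 by rewrite row ?eqxx.
  split => // j ij; have := row j (ltnW ij).
  rewrite ltn_eqF// => /eqP; rewrite mulf_eq0 => /orP[/eqP A0|/eqP//].
  by move: Aii; rewrite A0 mul0r => /esym/eqP; rewrite oner_eq0.
by split=> [i j /=|i]; [rewrite addn0; apply: (H i).2 | apply: (H i).1].
Qed.

Definition triangular_inverses (R : realType) s (A B : simx R) : Prop :=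
  [/\ band s 0 A, A ** B = @si1 R & B ** A = @si1 R].

Lemma triangular_inverse (R : realType) s (A B : simx R) :
  triangular_inverses s A B -> band s 0 B /\ forall i, A i i * B i i = 1.
Proof.
case: s => -[hA AB BA]; first exact: lower_inverse.
have [|hB AB1] := @lower_inverse R (sitr A) (sitr B) (band_tr hA).
  by rewrite -sitrM BA sitr1.
by split=> //; exact: (@band_tr R true _ (sitr B)).
Qed.

Lemma finite_product_mulable (R : realType) (A B : simx R) :
  finite_product A B -> mulable A B.
Proof.
by move=> fAB i j; have [n /cvg_series_finite/cvgP] := fAB i j.
Qed.

Lemma lower_unitriangular_band (R : realType) (A : simx R) :
  lower_unitriangular A -> band true 0 A.
Proof. by move=> [_ hA] i j /=; rewrite addn0; exact: hA. Qed.

(** The recursion for the rows of the inverse is unfolded by iteration: row [i]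
   does not change any more after [i + 1] steps. *)
Lemma lower_unitriangular_right_inverse (R : realType) (A : simx R) :
  lower_unitriangular A -> exists2 B, lower_unitriangular B & A ** B = @si1 R.
Proof.
move=> uA; have hA := lower_unitriangular_band uA; have [A1 A0] := uA.
pose F (B : simx R) : simx R :=
  fun i j => (i == j)%:R - \sum_(k < i) A i k * B k j.
pose B : simx R := fun i j => iter i.+1 F (0 : simx R) i j.
have stable n m i j : (i < n)%N -> (i < m)%N ->
    iter n F (0 : simx R) i j = iter m F (0 : simx R) i j.
  elim: n m i => [//|n IH] [//|m] i; rewrite !ltnS => ni mi /=.
  rewrite /F; congr (_ - _); apply: eq_bigr => k _.
  by rewrite (IH m)//; exact: leq_trans (ltn_ord k) _.
have BE i j : B i j = (i == j)%:R - \sum_(k < i) A i k * B k j.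
  rewrite {1}/B /= {1}/F; congr (_ - _); apply: eq_bigr => k _.
  by rewrite /B (stable i k.+1).
have AB : A ** B = @si1 R.
  apply/funext => i; apply/funext => j.
  by rewrite simul_lower_recr// A1 mul1r BE addrC subrK.
exists B => //; have [hB AB1] := lower_inverse hA AB.
split=> [i|i j ij]; last by apply: hB; rewrite /= addn0.
by have := AB1 i; rewrite A1 mul1r.
Qed.

(** A right inverse [B] has itself a right inverse [C], and associativity of
   [A ** B ** C] forces [C = A]: one-sided inverses are two-sided here. *)
Lemma lower_unitriangular_invertible (R : realType) (A : simx R) :
  lower_unitriangular A -> siinvertible A.
Proof.
move=> uA; have hA := lower_unitriangular_band uA.
have [B uB AB] := lower_unitriangular_right_inverse uA.
have hB := lower_unitriangular_band uB.
have [C uC BC] := lower_unitriangular_right_inverse uB.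
have AC : A = C by rewrite -[A]simul1r -BC (simulAl _ hA hB) AB simul1l.
exists B; split=> //; last by rewrite AC.
- by apply: finite_product_mulable; exact: finite_productl hA.
- by apply: finite_product_mulable; exact: finite_productl hB.
Qed.

Lemma siinvP (R : realType) (A : simx R) :
  siinvertible A -> is_siinv A (siinv A).
Proof. by move=> iA; exact: (@xgetPex (nat -> nat -> R)). Qed.

Lemma siinv_triangular (R : realType) s (A : simx R) :
  band s 0 A -> siinvertible A ->
  triangular_inverses s A (siinv A).
Proof. by move=> hA /siinvP[_ AB _ BA]. Qed.

(** * Entrywise derivatives *)

Definition is_mxderive (R : realType) (x : R) (A : R -> simx R) (dA : simx R) :
    Prop :=
  forall i j, is_derive x (1 : R) (fun y => A y i j) (dA i j).

Definition mxderivable (R : realType) (x : R) (A : R -> simx R) : Prop :=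
  forall i j, derivable (fun y => A y i j) x 1.

Definition mxderive (R : realType) (x : R) (A : R -> simx R) : simx R :=
  fun i j => 'D_1 (fun y => A y i j) x.

Lemma mxderivableP (R : realType) (x : R) (A : R -> simx R) :
  mxderivable x A -> is_mxderive x A (mxderive x A).
Proof. by move=> dA i j; exact: derivableP (dA i j). Qed.

Lemma is_mxderive_derivable (R : realType) (x : R) (A : R -> simx R) dA :
  is_mxderive x A dA -> mxderivable x A.
Proof. by move=> h i j; case: (h i j). Qed.

Lemma is_mxderive_unique (R : realType) (x : R) (A : R -> simx R) dA dA' :
  is_mxderive x A dA -> is_mxderive x A dA' -> dA = dA'.
Proof.
move=> h h'; apply/funext => i; apply/funext => j.
rewrite -(derive_val (is_derive := h i j)).
by rewrite (derive_val (is_derive := h' i j)).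
Qed.

Lemma is_mxderive_eq (R : realType) (x : R) (A : R -> simx R) dA dA' :
  is_mxderive x A dA -> dA = dA' -> is_mxderive x A dA'.
Proof. by move=> + <-. Qed.

Lemma near_eq_is_mxderive (R : realType) (x : R) (A B : R -> simx R) dA :
  (\forall y \near x, A y = B y) -> is_mxderive x A dA -> is_mxderive x B dA.
Proof.
move=> AB h i j; apply: near_eq_is_derive (h i j).
by apply: filterS AB => y ->.
Qed.

Lemma is_mxderive_cst (R : realType) (x : R) (A : simx R) :
  is_mxderive x (fun=> A) 0.
Proof. by move=> i j; exact: is_derive_cst. Qed.

Lemma is_mxderive_tr (R : realType) (x : R) (A : R -> simx R) dA :
  is_mxderive x A dA -> is_mxderive x (fun y => sitr (A y)) (sitr dA).
Proof. by move=> h i j; exact: h. Qed.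

(** A matrix of functions that stays in a band near [x] has locally zero entries
   outside of it. *)
Lemma band_mxderive (R : realType) s a (x : R) (A : R -> simx R) dA :
  (\forall y \near x, band s a (A y)) -> is_mxderive x A dA -> band s a dA.
Proof.
move=> hA h i j ij; rewrite -(derive_val (is_derive := h i j)).
rewrite (@near_eq_derive _ _ _ _ (cst 0))//; first exact: derive_cst.
by apply: filterS hA => y; apply.
Qed.

Lemma is_derive_sumM (R : realType) (x : R) n (f g : nat -> R -> R)
    (df dg : nat -> R) :
  (forall k, is_derive x 1 (f k) (df k)) ->
  (forall k, is_derive x 1 (g k) (dg k)) ->
  is_derive x 1 (fun y => \sum_(k < n) f k y * g k y)
     (\sum_(k < n) (df k * g k x + f k x * dg k)).
Proof.
move=> hf hg.
have -> : (fun y => \sum_(k < n) f k y * g k y) = \sum_(k < n) (f k * g k).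
  by apply/funext => y; rewrite fct_sumE.
apply: is_derive_sum => k; apply: is_derive_eq.
by rewrite addrC; congr (_ + _); rewrite /GRing.scale /= mulrC.
Qed.

(** Near [x], each entry of the product is one and the same finite sum; the
   uniform width [a] of the band is what makes its length independent of
   [y]. *)
Lemma is_mxderiveMl (R : realType) a (x : R) (A B : R -> simx R) dA dB :
  (\forall y \near x, band true a (A y)) ->
  is_mxderive x A dA -> is_mxderive x B dB ->
  is_mxderive x (fun y => A y ** B y) (dA ** B x + A x ** dB).
Proof.
move=> hA hdA hdB i j.
apply: (@near_eq_is_derive _ _ _
    (fun y => \sum_(k < (i + a).+1) A y i k * B y k j)).
  apply: filterS hA => y hAy.
  by rewrite (simul_lowerE (n := (i + a).+1) _ _ hAy).
apply: is_derive_eq.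
  exact: (is_derive_sumM _ (fun k => hdA i k) (fun k => hdB k j)).
rewrite -[RHS]/((dA ** B x) i j + (A x ** dB) i j).
rewrite (simul_lowerE (n := (i + a).+1) _ _ (band_mxderive hA hdA))//.
by rewrite (simul_lowerE (n := (i + a).+1) _ _ (nbhs_singleton hA))// big_split.
Qed.

Lemma is_mxderiveM (R : realType) s a b (x : R) (A B : R -> simx R) dA dB :
  (\forall y \near x, band s a (A y)) -> (\forall y \near x, band s b (B y)) ->
  is_mxderive x A dA -> is_mxderive x B dB ->
  is_mxderive x (fun y => A y ** B y) (dA ** B x + A x ** dB).
Proof.
case: s => hA hB hdA hdB; first exact: is_mxderiveMl hA _ _.
have -> : (fun y => A y ** B y) = (fun y => sitr (sitr (B y) ** sitr (A y))).
  by apply/funext => y; rewrite -sitrM.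
have -> : dA ** B x + A x ** dB =
    sitr (sitr dB ** sitr (A x) + sitr (B x) ** sitr dA).
  by rewrite (sitrD (sitr dB ** sitr (A x))) !sitrM !sitrK addrC.
apply: is_mxderive_tr; apply: (is_mxderiveMl (a := b)).
- by apply: filterS hB => y; exact: band_tr.
- exact: is_mxderive_tr.
- exact: is_mxderive_tr.
Qed.

(** The elementary step of Gaussian elimination. *)
Lemma derivable_pivot (R : realType) (x : R) n (h d : R -> R)
    (f g : nat -> R -> R) :
  d x != 0 -> derivable h x 1 -> derivable d x 1 ->
  (forall k, (k < n)%N -> derivable (f k) x 1) ->
  (forall k, (k < n)%N -> derivable (g k) x 1) ->
  derivable (fun y => (h y - \sum_(k < n) f k y * g k y) / d y) x 1.
Proof.
move=> dx hh hd hf hg.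
apply: (@derivableM _ _ (fun y => h y - \sum_(k < n) f k y * g k y)
  (fun y => (d y)^-1)).
  apply: derivableB => //.
  have -> : (fun y => \sum_(k < n) f k y * g k y) = \sum_(k < n) (f k * g k).
    by apply/funext => y; rewrite fct_sumE.
  by apply: derivable_sum => k; apply: derivableM; [exact: hf|exact: hg].
exact: derivableV.
Qed.

(** * Derivatives of inverses, of triangular factors and of conjugates *)

Lemma mulr1_neq0 (R : realType) (a b : R) : a * b = 1 -> a != 0.
Proof.
by move=> ab; apply: contra_eq_neq ab => ->; rewrite mul0r eq_sym oner_eq0.
Qed.

Lemma lower_inverse_derivable (R : realType) (x : R) (A B : R -> simx R) :
  (\forall y \near x, band true 0 (A y)) ->
  (\forall y \near x, A y ** B y = @si1 R) ->
  mxderivable x A -> mxderivable x B.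
Proof.
move=> hA AB dA; elim/ltn_ind => i IH j.
have hxy : \forall y \near x, A y i i != 0 /\
    (i == j)%:R = \sum_(k < i) A y i k * B y k j + A y i i * B y i j.
  apply: filterS2 hA AB => y hAy ABy; split.
    by have [_ /(_ i)/mulr1_neq0] := lower_inverse hAy ABy.
  by rewrite -simul_lower_recr// ABy.
apply: (@near_eq_derivable _ _ _
    (fun y => ((i == j)%:R - \sum_(k < i) A y i k * B y k j) / A y i i)).
  apply: filterS hxy => y [Aii ->].
  by rewrite addrAC subrr add0r mulrC mulKf.
apply: (derivable_pivot (h := cst _) (d := fun y => A y i i)
  (f := fun k y => A y i k) (g := fun k y => B y k j)) => //.
- by have [] := nbhs_singleton hxy.
- by move=> k /IH.
Qed.

Lemma triangular_inverse_derivable (R : realType) s (x : R)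
    (P Q : R -> simx R) :
  (\forall y \near x, triangular_inverses s (P y) (Q y)) ->
  mxderivable x P -> mxderivable x Q.
Proof.
case: s => hPQ dP.
  by apply: (lower_inverse_derivable (A := P)) => //;
    apply: filterS hPQ => y [].
have : mxderivable x (fun y => sitr (Q y)).
  apply: (lower_inverse_derivable (A := fun y => sitr (P y))).
  - by apply: filterS hPQ => y [hP _ _]; exact: (@band_tr R false).
  - by apply: filterS hPQ => y [_ _ QP]; rewrite -sitrM QP sitr1.
  - by move=> i j; exact: dP.
by move=> dQ i j; exact: (dQ j i).
Qed.

(** Differentiating [P Q = 1] gives the formula once [Q] is known to be
   differentiable, which forward substitution provides. *)
Lemma is_mxderive_inverse (R : realType) s (x : R) (P Q : R -> simx R) dP :
  (\forall y \near x, triangular_inverses s (P y) (Q y)) ->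
  is_mxderive x P dP -> is_mxderive x Q (- (Q x ** (dP ** Q x))).
Proof.
move=> hPQ hdP; set dQ := mxderive x Q.
have hdQ : is_mxderive x Q dQ.
  apply/mxderivableP/(triangular_inverse_derivable hPQ).
  exact: is_mxderive_derivable hdP.
have nP : \forall y \near x, band s 0 (P y) by apply: filterS hPQ => y [].
have nQ : \forall y \near x, band s 0 (Q y).
  by apply: filterS hPQ => y /triangular_inverse[].
have [hP PQ QP] := nbhs_singleton hPQ; have hQ := nbhs_singleton nQ.
have hbdP := band_mxderive nP hdP; have hbdQ := band_mxderive nQ hdQ.
have dPQ : dP ** Q x + P x ** dQ = 0.
  apply: (is_mxderive_unique (is_mxderiveM nP nQ hdP hdQ)).
  apply: near_eq_is_mxderive (is_mxderive_cst x (@si1 R)).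
  by apply: filterS hPQ => y [].
have PdQ : P x ** dQ = - (dP ** Q x).
  by apply/eqP; rewrite -addr_eq0 addrC dPQ.
suff -> : - (Q x ** (dP ** Q x)) = dQ by [].
rewrite -simulNr; last exact: band_finite_product hQ (band_mul hbdP hQ).
by rewrite -PdQ (simulA hQ hP hbdQ) QP simul1l.
Qed.

(** With [Q] the inverse of [P], [(P X Q)' = P' X Q - P X Q P' Q]; inserting
   [Q P = 1] before [X] in the first term gives the commutator of [P' Q] with
   [P X Q].  The constant matrix [X] will be a power of [Lambda] or of its
   transpose. *)
Lemma is_mxderive_conj (R : realType) s a (x : R) (P Q : R -> simx R) X dP :
  (\forall y \near x, triangular_inverses s (P y) (Q y)) ->
  band s a X -> is_mxderive x P dP ->
  is_mxderive x (fun y => P y ** X ** Q y)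
    (sicomm (dP ** Q x) (P x ** X ** Q x)).
Proof.
move=> hPQ hX hdP; have hdQ := is_mxderive_inverse hPQ hdP.
have nP : \forall y \near x, band s 0 (P y) by apply: filterS hPQ => y [].
have nQ : \forall y \near x, band s 0 (Q y).
  by apply: filterS hPQ => y /triangular_inverse[].
have nX : \forall y \near x, band s a X by apply: filterE.
have [hP PQ QP] := nbhs_singleton hPQ; have hQ := nbhs_singleton nQ.
have hbdP := band_mxderive nP hdP.
have nPX : \forall y \near x, band s (0 + a) (P y ** X).
  by apply: filterS nP => y hPy; exact: band_mul.
have hPX := nbhs_singleton nPX.
have hdPQ := band_mul hbdP hQ.
suff <- : (dP ** X + P x ** 0) ** Q x + P x ** X ** - (Q x ** (dP ** Q x)) =
    sicomm (dP ** Q x) (P x ** X ** Q x).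
  apply: (is_mxderiveM nPX nQ _ hdQ).
  exact: is_mxderiveM nP nX hdP (is_mxderive_cst x X).
rewrite -[RHS]/((dP ** Q x) ** (P x ** X ** Q x) -
  (P x ** X ** Q x) ** (dP ** Q x)).
have -> : P x ** 0 = 0.
  by apply: (can_inj (@sitrK R)); rewrite sitrM; exact: simul0l.
rewrite addr0 simulNr; last first.
  exact: band_finite_product hPX (band_mul hQ hdPQ).
rewrite (simulA hPX hQ hdPQ); congr (_ - _).
rewrite (simulA hdPQ hPX hQ) -(simulA hbdP hQ hPX) (simulA hQ hP hX) QP.
by rewrite simul1l.
Qed.

(** Entry [(m, j)] of [U] and entry [(i, m)] of [M] come from those of [M ** U]
   by Gaussian elimination, where the only divisions are by the pivots
   [U m m]. *)
Lemma LU_derivable (R : realType) (x : R) (G M U : R -> simx R) :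
  (\forall y \near x, [/\ G y = M y ** U y, lower_unitriangular (M y),
     upper_triangular (U y) & forall i, U y i i != 0]) ->
  mxderivable x G -> mxderivable x M /\ mxderivable x U.
Proof.
move=> hLU dG.
have H m : (forall i, derivable (fun y => M y i m) x 1) /\
           (forall j, derivable (fun y => U y m j) x 1).
  elim/ltn_ind: m => m IH.
  have dMx k : (k < m)%N -> forall i, derivable (fun y => M y i k) x 1.
    by move=> /IH[].
  have dUx k : (k < m)%N -> forall i, derivable (fun y => U y k i) x 1.
    by move=> /IH[].
  have dU j : derivable (fun y => U y m j) x 1.
    apply: (@near_eq_derivable _ _ _
        (fun y => (G y m j - \sum_(k < m) M y m k * U y k j) / 1)).
      apply: filterS hLU => y [-> uM _ _].
      rewrite (simul_lower_recr _ _ _ (lower_unitriangular_band uM)).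
      by rewrite (proj1 uM) mul1r divr1 addrAC subrr add0r.
    apply: (derivable_pivot (h := fun y => G y m j) (d := cst 1)
      (f := fun k y => M y m k) (g := fun k y => U y k j)) => //.
    - by rewrite oner_eq0.
    - by move=> k km; exact: dMx.
    - by move=> k km; exact: dUx.
  split=> // i; apply: (@near_eq_derivable _ _ _
      (fun y => (G y i m - \sum_(k < m) M y i k * U y k m) / U y m m)).
    apply: filterS hLU => y [-> _ uU Umm].
    rewrite (simul_upperE (a := 0) (n := m.+1)) ?addn0//; last first.
      by move=> k l /=; rewrite addn0; exact: uU.
    by rewrite big_ord_recr /= addrAC subrr add0r mulfK.
  apply: (derivable_pivot (h := fun y => G y i m) (d := fun y => U y m m)
    (f := fun k y => M y i k) (g := fun k y => U y k m)) => //.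
  - by have [] := nbhs_singleton hLU.
  - by move=> k km; exact: dMx.
  - by move=> k km; exact: dUx.
by split=> i j; [exact: (H j).1 | exact: (H i).2].
Qed.

(** * The time exponentials *)

Lemma sipowseries_LambdaE (R : realType) (u : nat -> R) i j :
  sipowseries u (@Lambda R) i j = if (i <= j)%N then u (j - i)%N else 0.
Proof.
rewrite /sipowseries (limn_series_finite (n := j.+1)) => [|k jk]; last first.
  by rewrite sipow_LambdaE gtn_eqF ?mulr0//; lia.
case: leqP => ij; last first.
  by apply: big1 => k _; rewrite sipow_LambdaE gtn_eqF ?mulr0//; lia.
have ltk : (j - i < j.+1)%N by lia.
rewrite (bigD1 (Ordinal ltk)) //= big1 ?addr0 => [|k]; rewrite sipow_LambdaE.
  by rewrite subnKC// eqxx mulr1.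
rewrite -val_eqE /= => kij; case: eqP => [?|]; last by rewrite mulr0.
by move: kij; rewrite (_ : (k : nat) = j - i)%N ?eqxx//; lia.
Qed.

Lemma simul_LambdaE (R : realType) (A : simx R) r i j :
  (A ** sipow (@Lambda R) r) i j = if (r <= j)%N then A i (j - r)%N else 0.
Proof.
rewrite (simul_finite (n := j.+1)) => [|k jk]; last first.
  by rewrite sipow_LambdaE gtn_eqF ?mulr0//; lia.
case: leqP => rj; last first.
  by apply: big1 => k _; rewrite sipow_LambdaE gtn_eqF ?mulr0//; lia.
have ltk : (j - r < j.+1)%N by lia.
rewrite (bigD1 (Ordinal ltk)) //= big1 ?addr0 => [|k]; rewrite sipow_LambdaE.
  by rewrite subnK// eqxx mulr1.
rewrite -val_eqE /= => krj; case: eqP => [?|]; last by rewrite mulr0.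
by move: krj; rewrite (_ : (k : nat) = j - r)%N ?eqxx//; lia.
Qed.

Lemma band_sipow_Lambda (R : realType) r : band false 0 (sipow (@Lambda R) r).
Proof. by move=> i j /= ij; rewrite sipow_LambdaE gtn_eqF//; lia. Qed.

Section Toeplitz.
Context (R : realType) (u : nat -> R).
Let A := sipowseries u (@Lambda R).

Lemma band_sipowseries : band false 0 A.
Proof.
move=> i j /= ij; rewrite /A sipowseries_LambdaE leqNgt.
by case: ltnP => //; lia.
Qed.

Lemma sipowseries_comm r :
  A ** sipow (@Lambda R) r = sipow (@Lambda R) r ** A.
Proof.
apply/funext => i; apply/funext => j.
rewrite simul_LambdaE Lambda_simul /A !sipowseries_LambdaE.
case: (leqP r j) => rj; last by rewrite leqNgt (_ : (j < i + r)%N)//; lia.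
rewrite (_ : (i <= j - r)%N = (i + r <= j)%N); last by lia.
by case: ifP => // _; congr u; lia.
Qed.

Lemma sipow_sipowseries_comm r n :
  sipow A n ** sipow (@Lambda R) r = sipow (@Lambda R) r ** sipow A n.
Proof.
have hA := band_sipowseries; have hL := @band_sipow_Lambda R r.
elim: n => [|n IH]; first by rewrite simul1l simul1r.
have hAn := band_sipow (n := n) hA.
rewrite -[sipow A n.+1]/(A ** sipow A n) -(simulA hA hAn hL) IH.
by rewrite (simulA hA hL hAn) sipowseries_comm (simulA hL hA hAn).
Qed.

Hypothesis u0 : u 0%N = 0.

(** Without constant term, each factor moves strictly to the right, so that the
   exponential series has finitely many nonzero terms in each entry. *)
Lemma sipow_sipowseries0 n i j : (j < i + n)%N -> sipow A n i j = 0.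
Proof.
elim: n i => [|n IH] i ij.
  by rewrite /= /si1; case: eqP => //; lia.
rewrite -[sipow A n.+1]/(A ** sipow A n) (simul_finite (n := 0)).
  by rewrite big_ord0.
move=> k _.
case: (leqP k i) => ki; last by rewrite IH ?mulr0//; lia.
rewrite /A sipowseries_LambdaE; case: leqP => ik; rewrite ?mul0r//.
by rewrite (_ : (k - i)%N = 0%N) ?u0 ?mul0r//; lia.
Qed.

Lemma W10E m i j : (j < m)%N ->
  W10 u i j = \sum_(n < m) (n`!%:R)^-1 * sipow A n i j.
Proof.
by move=> jm; rewrite /W10 /siexp (limn_series_finite (n := m)) // => n mn;
  rewrite sipow_sipowseries0 ?mulr0//; lia.
Qed.

Lemma W10_diag i : W10 u i i = 1.
Proof.
rewrite (W10E _ (ltnSn i)) big_ord_recl big1 => [|n _].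
  by rewrite /sipow /= /si1 eqxx fact0 invr1 mulr1 addr0.
by rewrite sipow_sipowseries0 ?mulr0// lift0; lia.
Qed.

Lemma band_W10 : band false 0 (W10 u).
Proof.
move=> i j /= ij; rewrite (W10E _ (ltnSn j)) big1// => n _.
by rewrite sipow_sipowseries0 ?mulr0//; lia.
Qed.

(** Needed after transposition: it lets the derivative of the second exponential
   be written with the shift on the side where it cancels in the derivative of
   the inverse. *)
Lemma W10_comm r :
  W10 u ** sipow (@Lambda R) r = sipow (@Lambda R) r ** W10 u.
Proof.
apply/funext => i; apply/funext => j; rewrite Lambda_simul simul_LambdaE.
rewrite (W10E _ (ltnSn j)); case: leqP => rj.
  rewrite (W10E _ (_ : (j - r < j.+1)%N)); last by lia.
  apply: eq_bigr => n _; congr (_ * _).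
  by rewrite -Lambda_simul -sipow_sipowseries_comm simul_LambdaE rj.
rewrite big1// => n _.
by rewrite sipow_sipowseries0 ?mulr0//; lia.
Qed.

End Toeplitz.

Lemma sipowseries_tr (R : realType) (u : nat -> R) :
  sipowseries u (sitr (@Lambda R)) = sitr (sipowseries u (@Lambda R)).
Proof.
apply/funext => i; apply/funext => j; rewrite /sipowseries /sitr.
congr (limn (series _)); apply/funext => k; congr (_ * _).
by rewrite (sipow_tr _ (@band_Lambda R)).
Qed.

Lemma W20E (R : realType) (u : nat -> R) : W20 u = sitr (W10 u).
Proof.
rewrite /W20 sipowseries_tr; apply/funext => i; apply/funext => j.
rewrite /siexp /W10 /siexp /sitr; congr (limn (series _)); apply/funext => k.
by congr (_ * _); rewrite (sipow_tr _ (@band_sipowseries R u)).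
Qed.

Lemma lower_unitriangular_W20 (R : realType) (u : nat -> R) :
  u 0%N = 0 -> lower_unitriangular (W20 u).
Proof.
move=> u0; rewrite W20E; split=> [i|i j ij]; first exact: W10_diag.
by apply: band_W10 => //=; rewrite addn0.
Qed.

Definition replace_at (R : realType) (u : nat -> R) r (y : R) : nat -> R :=
  fun k => if k == r then y else u k.

Lemma replace_at0 (R : realType) (u : nat -> R) r (y : R) :
  (0 < r)%N -> u 0%N = 0 -> replace_at u r y 0%N = 0.
Proof. by rewrite /replace_at; case: r. Qed.

Lemma simulZr (R : realType) (A B : simx R) c : finite_product A B ->
  A ** (fun i j => c * B i j) = (fun i j => c * (A ** B) i j).
Proof.
move=> fAB; apply/funext => i; apply/funext => j; have [n hn] := fAB i j.
rewrite !(simul_finite (n := n)) => [|k /hn//|k /hn e]; last first.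
  by rewrite mulrCA e mulr0.
by rewrite mulr_sumr; apply: eq_bigr => k _; rewrite mulrCA.
Qed.

Lemma is_mxderive_sipowseries (R : realType) (u : nat -> R) r (x : R) :
  is_mxderive x (fun y => sipowseries (replace_at u r y) (@Lambda R))
    (sipow (@Lambda R) r).
Proof.
move=> i j; rewrite sipow_LambdaE.
under eq_fun do rewrite sipowseries_LambdaE.
case: leqP => ij; last first.
  by rewrite gtn_eqF; [exact: is_derive_cst|lia].
rewrite /replace_at (_ : (i + r == j)%N = (j - i == r)%N); last by lia.
by case: eqP => _; [exact: is_derive_id | exact: is_derive_cst].
Qed.

(** The usual derivative of a power, valid because the derivative [Lambda ^ r]
   of the base commutes with the base. *)
Lemma is_mxderive_sipow_sipowseries (R : realType) (u : nat -> R) r (x : R) n :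
  is_mxderive x (fun y => sipow (sipowseries (replace_at u r y) (@Lambda R)) n)
    (fun i j => n%:R *
      (sipow (sipowseries (replace_at u r x) (@Lambda R)) n.-1 **
       sipow (@Lambda R) r) i j).
Proof.
set A := fun y => sipowseries (replace_at u r y) (@Lambda R).
set L := sipow _ r.
have hA y : band false 0 (A y) := band_sipowseries _.
have hL : band false 0 L by exact: band_sipow_Lambda.
elim: n => [|n IH].
  by move=> i j; rewrite mul0r; exact: is_derive_cst.
have nA : \forall y \near x, band false 0 (A y) by apply: filterE.
have nAn : \forall y \near x, band false (n * 0) (sipow (A y) n).
  by apply: filterE => y; exact: band_sipow.
apply: is_mxderive_eq
  (is_mxderiveM nA nAn (is_mxderive_sipowseries u r x) IH) _.
rewrite simulZr; last first.
  exact: band_finite_product (hA x) (band_mul (band_sipow (hA x)) hL).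
apply/funext => i; apply/funext => j.
rewrite -[LHS]/((L ** sipow (A x) n) i j +
  n%:R * (A x ** (sipow (A x) n.-1 ** L)) i j).
rewrite -sipow_sipowseries_comm (simulA (hA x) (band_sipow (hA x)) hL).
case: n {IH nAn} => [|n]; first by rewrite mul0r addr0 mul1r.
by rewrite -[n.+2%:R]natr1 mulrDl mul1r addrC.
Qed.

Lemma is_mxderive_W10 (R : realType) (u : nat -> R) r (x : R) :
  (0 < r)%N -> u 0%N = 0 ->
  is_mxderive x (fun y => W10 (replace_at u r y))
    (sipow (@Lambda R) r ** W10 (replace_at u r x)).
Proof.
move=> r0 u0 i j; rewrite Lambda_simul.
have v0 y : replace_at u r y 0%N = 0 by exact: replace_at0.
have jj : (j < j.+2)%N by lia.
under eq_fun do rewrite (W10E (v0 _) _ jj).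
rewrite (W10E (v0 _) _ (ltnSn j)).
pose F n y :=
  (n`!%:R)^-1 * sipow (sipowseries (replace_at u r y) (@Lambda R)) n i j.
rewrite -[X in is_derive _ _ X _]/(fun y => \sum_(n < j.+2) F n y).
have -> : (fun y => \sum_(n < j.+2) F n y) = \sum_(n < j.+2) F n.
  by apply/funext => y; rewrite fct_sumE.
have dF n : is_derive x 1 (F n) ((n`!%:R)^-1 * (n%:R *
      (sipow (sipowseries (replace_at u r x) (@Lambda R)) n.-1 **
       sipow (@Lambda R) r) i j)).
  apply: (@is_deriveZ _ _ _ _ (n`!%:R^-1)).
  exact: is_mxderive_sipow_sipowseries.
(* The constant term disappears, and the sum is shifted by one. *)
apply: is_derive_eq; rewrite big_ord_recl mul0r mulr0 add0r.
apply: eq_bigr => n _; rewrite lift0 factS natrM invfM.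
rewrite sipow_sipowseries_comm Lambda_simul mulrA; congr (_ * _).
by rewrite mulrAC mulVf ?mul1r// pnatr_eq0.
Qed.

(** With [V] the inverse of [E], [V' = - V E' V] and [E' = (Lambda^T) ^ r E], so
   that [E V = 1] leaves [- V (Lambda^T) ^ r]. *)
Lemma is_mxderive_siinv_W20 (R : realType) (u : nat -> R) r (x : R) :
  (0 < r)%N -> u 0%N = 0 ->
  is_mxderive x (fun y => siinv (W20 (replace_at u r y)))
    (- (siinv (W20 (replace_at u r x)) ** sipow (sitr (@Lambda R)) r)).
Proof.
move=> r0 u0.
have v0 y : replace_at u r y 0%N = 0 by exact: replace_at0.
have inv y := siinv_triangular
  (lower_unitriangular_band (lower_unitriangular_W20 (v0 y)))
  (lower_unitriangular_invertible (lower_unitriangular_W20 (v0 y))).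
have hW y := lower_unitriangular_band (lower_unitriangular_W20 (v0 y)).
have dW : is_mxderive x (fun y => W20 (replace_at u r y))
    (sitr (sipow (@Lambda R) r) ** W20 (replace_at u r x)).
  have -> : (fun y => W20 (replace_at u r y)) =
      (fun y => sitr (W10 (replace_at u r y))).
    by apply/funext => y; rewrite W20E.
  rewrite W20E -sitrM W10_comm//.
  exact: is_mxderive_tr (is_mxderive_W10 x r0 u0).
have [_ WV _] := inv x; have [hV _] := triangular_inverse (inv x).
have hL := band_tr (@band_sipow_Lambda R r).
have hWV : \forall y \near x,
    triangular_inverses true (W20 (replace_at u r y))
      (siinv (W20 (replace_at u r y))).
  by apply: filterE => y; exact: inv.
apply: is_mxderive_eq (is_mxderive_inverse hWV dW) _.
by rewrite -(simulA hL (hW x) hV) WV simul1r (sipow_tr _ (@band_Lambda R)).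
Qed.

(** * The deformed moment matrix and the Lax equations *)

Lemma replace_at_id (R : realType) (u : nat -> R) r : replace_at u r (u r) = u.
Proof. by apply/funext => k; rewrite /replace_at; case: eqP => // ->. Qed.

Lemma set_t1_id (R : realType) (t : times R) r : set_t1 t r (t.1 r) = t.
Proof.
by case: t => u v; rewrite /set_t1 /= -/(replace_at u r (u r)) replace_at_id.
Qed.

Lemma set_t2_id (R : realType) (t : times R) r : set_t2 t r (t.2 r) = t.
Proof.
by case: t => u v; rewrite /set_t2 /= -/(replace_at v r (v r)) replace_at_id.
Qed.

Lemma limn_seriesZ (R : realType) (f : nat -> R) (c : R) :
  cvgn (series f) -> limn (series (fun k => f k * c)) = limn (series f) * c.
Proof.
move=> cf; rewrite mulrC -[RHS]/(c *: _) -lim_seriesZ//.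
by congr (limn (series _)); apply/funext => k; rewrite mulrC.
Qed.

Lemma is_derive_unique (R : realType) (x : R) (f g : R -> R) df dg :
  f =1 g -> is_derive x 1 f df -> is_derive x 1 g dg -> df = dg.
Proof. by move=> /funext-> [_ <-] [_ <-]. Qed.

(** By uniqueness of derivatives, the termwise derivatives are known: they are
   the terms of the series for the entry of the deformation [r] rows below,
   whose convergence is part of the hypotheses. *)
Lemma deformation_derive1 (R : realType) (G : simx R) (t : times R) r :
  (0 < r)%N -> t.1 0%N = 0 -> deformation_defined G t ->
  termwise_derivable G (set_t1 t r) (t.1 r) ->
  is_mxderive (t.1 r) (fun y => deformation G (set_t1 t r y))
    (sipow (@Lambda R) r ** deformation G t).
Proof.
move=> r0 t0 [cWG _] dG n p; have [dT [hdT _ _ hG]] := dG n p.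
have dW := is_mxderive_W10 (t.1 r) r0 t0; rewrite replace_at_id in dW.
apply: is_derive_eq hG _; rewrite Lambda_simul; congr (limn (series _)).
apply/funext => l; rewrite -[RHS]limn_seriesZ; last exact: cWG.
congr (limn (series _)); apply/funext => k.
have hF := is_deriveZ (G k l * siinv (W20 t.2) l p) (dW n k).
rewrite -[RHS]mulrA mulrC -Lambda_simul.
apply: is_derive_unique (hdT l k) hF => y.
by rewrite /deformation_term -mulrA mulrC.
Qed.

Lemma deformation_derive2 (R : realType) (G : simx R) (t : times R) r :
  (0 < r)%N -> t.2 0%N = 0 -> deformation_defined G t ->
  termwise_derivable G (set_t2 t r) (t.2 r) ->
  is_mxderive (t.2 r) (fun y => deformation G (set_t2 t r y))
    (- (deformation G t ** sipow (sitr (@Lambda R)) r)).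
Proof.
move=> r0 t0 [cWG cWGV] dG n p; have [dT [hdT _ _ hG]] := dG n p.
have dV := is_mxderive_siinv_W20 (t.2 r) r0 t0; rewrite replace_at_id in dV.
have dTE l k : dT l k = - (W10 t.1 n k * G k l * siinv (W20 t.2) l (p + r)%N).
  have hF := is_deriveZ (W10 t.1 n k * G k l) (dV l p).
  rewrite -mulrN -simul_trLambda.
  by apply: is_derive_unique (hdT l k) hF.
apply: is_derive_eq hG _.
rewrite -[RHS]/(- ((deformation G t ** sipow (sitr (@Lambda R)) r) n p)).
rewrite simul_trLambda /deformation -lim_seriesN; last exact: cWGV.
congr (limn (series _)); apply/funext => l.
rewrite -[RHS]/(- ((W10 t.1 ** G) n l * siinv (W20 t.2) l (p + r)%N)) -mulrN.
rewrite -limn_seriesZ; last exact: cWG.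
by congr (limn (series _)); apply/funext => k; rewrite dTE mulrN.
Qed.

Lemma band_strict_lower_part (R : realType) s a (A : simx R) :
  band s a A -> band s a (strict_lower_part A).
Proof. by move=> hA i j /hA Aij; rewrite /strict_lower_part Aij if_same. Qed.

Lemma band_upper_part (R : realType) s a (A : simx R) :
  band s a A -> band s a (upper_part A).
Proof. by move=> hA i j /hA Aij; rewrite /upper_part Aij if_same. Qed.

Lemma upper_partE (R : realType) (A : simx R) :
  upper_part A = A - strict_lower_part A.
Proof.
apply/funext => i; apply/funext => j.
rewrite -[RHS]/(A i j - strict_lower_part A i j) /upper_part /strict_lower_part.
by case: leqP => _; rewrite ?subr0 ?subrr.
Qed.

(** Exchanges the two triangular parts of a power of a Lax operator in its
   commutator with another power of the same operator. *)
Lemma sicommN_commute (R : realType) s a b c (A B C : simx R) :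
  band s a A -> band s b B -> band s c C -> A ** C = C ** A ->
  sicomm (- B) C = sicomm (A - B) C.
Proof.
move=> hA hB hC AC.
rewrite -[LHS]/((- B) ** C - C ** (- B)) -[RHS]/((A - B) ** C - C ** (A - B)).
have fBC := band_finite_product hB hC; have fCB := band_finite_product hC hB.
rewrite simulNl// simulNr// simulBl//; last exact: band_finite_product hA hC.
rewrite simulBr//; last exact: band_finite_product hC hA.
by rewrite AC opprK opprB [RHS]addrC addrA subrK addrC.
Qed.

(** The factorization is studied along a curve, which will be one of the
   coordinate lines through a given time; [G], [S1] and [S2] are only
   controlled near [x]. *)
Section Factorization.
Context (R : realType) (x : R) (G S1 S2 : R -> simx R).
Hypothesis hS : \forall y \near x,
  [/\ lower_unitriangular (S1 y), upper_triangular (S2 y), siinvertible (S2 y) &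
      G y = siinv (S1 y) ** S2 y].

Let S1P : \forall y \near x,
  triangular_inverses true (S1 y) (siinv (S1 y)).
Proof.
apply: filterS hS => y [uS1 _ _ _]; have h := lower_unitriangular_band uS1.
exact: siinv_triangular h (lower_unitriangular_invertible uS1).
Qed.

Let S2P : \forall y \near x,
  triangular_inverses false (S2 y) (siinv (S2 y)).
Proof.
apply: filterS hS => y [_ uS2 iS2 _].
have h : band false 0 (S2 y) by move=> i j /=; rewrite addn0; exact: uS2.
exact: siinv_triangular h iS2.
Qed.

Lemma factors_derivable :
  mxderivable x G -> mxderivable x S1 /\ mxderivable x S2.
Proof.
move=> dG.
have [|dM dS2] := @LU_derivable R x G (fun y => siinv (S1 y)) S2 _ dG.
  apply: filterS3 hS S1P S2P => y [[S1d _] uS2 iS2 GE] MP QP.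
  have [hM SM1] := triangular_inverse MP.
  have [_ SQ1] := triangular_inverse QP.
  split=> // [|i]; last exact: mulr1_neq0 (SQ1 i).
  split=> [i|i j ij]; first by have := SM1 i; rewrite S1d mul1r.
  by apply: hM; rewrite /= addn0.
split=> //.
apply: (@triangular_inverse_derivable _ true _ (fun y => siinv (S1 y))) => //.
apply: filterS S1P => y MP; have [_ SM MS] := MP; split=> //.
by have [] := triangular_inverse MP.
Qed.

(** Differentiating [S1 G = S2] and multiplying by [S2^-1] on the right gives
   [S2' S2^-1 = S1' S1^-1 + Z].  The left-hand side is upper triangular, while
   [S1' S1^-1] is strictly lower triangular since [S1] has constant diagonal:
   the two are read off from the triangular parts of [Z]. *)
Lemma factors_derive dG : is_mxderive x G dG ->
  let Z := S1 x ** dG ** siinv (S2 x) in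
  exists dS1 dS2, [/\ is_mxderive x S1 dS1, is_mxderive x S2 dS2,
    dS1 ** siinv (S1 x) = - strict_lower_part Z &
    dS2 ** siinv (S2 x) = upper_part Z].
Proof.
move=> hdG Z; have [dS1 dS2] := factors_derivable (is_mxderive_derivable hdG).
exists (mxderive x S1), (mxderive x S2).
move: dS1 dS2 => /mxderivableP hdS1 /mxderivableP hdS2.
set dS1 := mxderive x S1 in hdS1 *; set dS2 := mxderive x S2 in hdS2 *.
have nS1 : \forall y \near x, band true 0 (S1 y) by apply: filterS S1P => y [].
have nS2 : \forall y \near x, band false 0 (S2 y) by apply: filterS S2P => y [].
have hbdS1 := band_mxderive nS1 hdS1; have hbdS2 := band_mxderive nS2 hdS2.
have [hS1 S1M _] := nbhs_singleton S1P.
have [hM _] := triangular_inverse (nbhs_singleton S1P).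
have [hS2 S2Q _] := nbhs_singleton S2P.
have [hQ _] := triangular_inverse (nbhs_singleton S2P).
have GE : G x = siinv (S1 x) ** S2 x by have [] := nbhs_singleton hS.
have S1G : dS1 ** G x + S1 x ** dG = dS2.
  apply: is_mxderive_unique (is_mxderiveMl nS1 hdS1 hdG) _.
  apply: near_eq_is_mxderive hdS2; apply: filterS2 hS S1P => y [_ _ _ ->] MP.
  have [hS1y SM _] := MP; have [hMy _] := triangular_inverse MP.
  by rewrite (simulAl _ hS1y hMy) SM simul1l.
have key : dS2 ** siinv (S2 x) = dS1 ** siinv (S1 x) + Z.
  rewrite -S1G simulDl; [|exact: finite_productr hQ..].
  rewrite GE (simulAl _ hbdS1 hM) -(simulAm _ (band_mul hbdS1 hM) hQ).
  by rewrite S2Q simul1r.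
have keyE i j : (dS2 ** siinv (S2 x)) i j = (dS1 ** siinv (S1 x)) i j + Z i j.
  by rewrite key.
have dS1d i : dS1 i i = 0.
  have dcst : is_derive x 1 (fun y => S1 y i i) 0.
    apply: near_eq_is_derive (is_derive_cst (1 : R) x (1 : R)).
    by apply: filterS hS => y [[S1d _] _ _ _]; rewrite S1d.
  exact: is_derive_unique (frefl _) (hdS1 i i) dcst.
have low i j : (i <= j)%N -> (dS1 ** siinv (S1 x)) i j = 0.
  move=> ij; rewrite simul_lower_recr// dS1d mul0r addr0 big1// => k _.
  by rewrite hM ?mulr0//= addn0; exact: leq_trans ij.
have up i j : (j < i)%N -> (dS2 ** siinv (S2 x)) i j = 0.
  by move=> ij; apply: (band_mul hbdS2 hQ); rewrite /= !addn0.
split=> //; apply/funext => i; apply/funext => j.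
  rewrite -[RHS]/(- strict_lower_part Z i j) /strict_lower_part.
  case: ltnP => ij; last by rewrite low ?oppr0.
  by apply/eqP; rewrite -addr_eq0 -keyE up.
by rewrite /upper_part; case: leqP => ij; [rewrite keyE low ?add0r|rewrite up].
Qed.

Lemma Lax1_conj y j : lower_unitriangular (S1 y) ->
  sipow (Lax1 (S1 y)) j = S1 y ** sipow (@Lambda R) j ** siinv (S1 y).
Proof.
move=> uS1; have h := lower_unitriangular_band uS1.
have MP := siinv_triangular h (lower_unitriangular_invertible uS1).
have [_ SM MS] := MP; have [hM _] := triangular_inverse MP.
exact: sipow_conj h hM (@band_Lambda R) SM MS.
Qed.

Lemma Lax2_conj y j : upper_triangular (S2 y) -> siinvertible (S2 y) ->
  sipow (Lax2 (S2 y)) j = S2 y ** sipow (sitr (@Lambda R)) j ** siinv (S2 y).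
Proof.
move=> uS2 iS2.
have h : band false 0 (S2 y) by move=> i k /=; rewrite addn0; exact: uS2.
have MP := siinv_triangular h iS2.
have [_ SM MS] := MP; have [hM _] := triangular_inverse MP.
exact: sipow_conj h hM (band_tr (@band_Lambda R)) SM MS.
Qed.

Lemma Lax_derive dG Z j : is_mxderive x G dG ->
  S1 x ** dG ** siinv (S2 x) = Z ->
  is_mxderive x (fun y => sipow (Lax1 (S1 y)) j)
    (sicomm (- strict_lower_part Z) (sipow (Lax1 (S1 x)) j)) /\
  is_mxderive x (fun y => sipow (Lax2 (S2 y)) j)
    (sicomm (upper_part Z) (sipow (Lax2 (S2 x)) j)).
Proof.
move=> /factors_derive[dS1 [dS2 [hdS1 hdS2 dS1M dS2Q]]] ZE.
rewrite -ZE -dS1M -dS2Q.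
have [uS1 uS2 iS2 _] := nbhs_singleton hS; rewrite Lax1_conj// Lax2_conj//.
split.
  apply: near_eq_is_mxderive
    (is_mxderive_conj S1P (band_sipow (@band_Lambda R)) hdS1).
  by apply: filterS hS => y [? _ _ _]; rewrite Lax1_conj.
apply: near_eq_is_mxderive
  (is_mxderive_conj S2P (band_sipow (band_tr (@band_Lambda R))) hdS2).
by apply: filterS hS => y [_ ? ? _]; rewrite Lax2_conj.
Qed.

(** Here [Z = S1 Lambda ^ r G S2^-1] is the [r]-th power of the first Lax
   operator. *)
Lemma Lax_flow1 r j : is_mxderive x G (sipow (@Lambda R) r ** G x) ->
  is_mxderive x (fun y => sipow (Lax1 (S1 y)) j)
    (sicomm (upper_part (sipow (Lax1 (S1 x)) r)) (sipow (Lax1 (S1 x)) j)) /\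
  is_mxderive x (fun y => sipow (Lax2 (S2 y)) j)
    (sicomm (upper_part (sipow (Lax1 (S1 x)) r)) (sipow (Lax2 (S2 x)) j)).
Proof.
move=> hdG; have [uS1 uS2 iS2 GE] := nbhs_singleton hS.
have [hS1 S1M _] := nbhs_singleton S1P.
have [hM _] := triangular_inverse (nbhs_singleton S1P).
have [hS2 S2Q _] := nbhs_singleton S2P.
have [hQ _] := triangular_inverse (nbhs_singleton S2P).
have hL := band_sipow (n := r) (@band_Lambda R).
have ZE : S1 x ** (sipow (@Lambda R) r ** G x) ** siinv (S2 x) =
    sipow (Lax1 (S1 x)) r.
  rewrite GE (simulAl _ hL hM) (simulAl _ hS1 (band_mul hL hM)).
  rewrite -(simulAm _ (band_mul hS1 (band_mul hL hM)) hQ) S2Q simul1r.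
  by rewrite (simulAl _ hS1 hL) -Lax1_conj.
have hLax : band true (0 + 1 + 0) (Lax1 (S1 x)).
  exact: band_mul (band_mul hS1 (@band_Lambda R)) hM.
have hr := band_sipow (n := r) hLax; have hj := band_sipow (n := j) hLax.
have := Lax_derive j hdG ZE.
rewrite (sicommN_commute hr (band_strict_lower_part hr) hj) -?upper_partE//.
by rewrite !(sipowD _ _ hLax) addnC.
Qed.

(** Here [Z = - S1 G (Lambda^T) ^ r S2^-1] is minus the [r]-th power of the
   second Lax operator. *)
Lemma Lax_flow2 r j : is_mxderive x G (- (G x ** sipow (sitr (@Lambda R)) r)) ->
  is_mxderive x (fun y => sipow (Lax1 (S1 y)) j)
    (sicomm (strict_lower_part (sipow (Lax2 (S2 x)) r))
      (sipow (Lax1 (S1 x)) j)) /\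
  is_mxderive x (fun y => sipow (Lax2 (S2 y)) j)
    (sicomm (strict_lower_part (sipow (Lax2 (S2 x)) r))
      (sipow (Lax2 (S2 x)) j)).
Proof.
move=> hdG; have [uS1 uS2 iS2 GE] := nbhs_singleton hS.
have [hS1 S1M _] := nbhs_singleton S1P.
have [hM _] := triangular_inverse (nbhs_singleton S1P).
have [hS2 S2Q _] := nbhs_singleton S2P.
have [hQ _] := triangular_inverse (nbhs_singleton S2P).
have hL := band_sipow (n := r) (band_tr (@band_Lambda R)).
have ZE : S1 x ** (- (G x ** sipow (sitr (@Lambda R)) r)) ** siinv (S2 x) =
    - sipow (Lax2 (S2 x)) r.
  rewrite GE -(simulAm _ hM hL) simulNr; last exact: finite_productl hS1.
  rewrite simulNl; last exact: finite_productr hQ.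
  by rewrite (simulAl _ hS1 hM) S1M simul1l -Lax2_conj.
have hLax : band false (0 + 1 + 0) (Lax2 (S2 x)).
  exact: band_mul (band_mul hS2 (band_tr (@band_Lambda R))) hQ.
have hr := band_sipow (n := r) hLax; have hj := band_sipow (n := j) hLax.
have := Lax_derive j hdG ZE; set A := sipow (Lax2 (S2 x)) r in hr *.
have -> : - strict_lower_part (- A) = strict_lower_part A.
  apply/funext => i; apply/funext => k.
  rewrite -[LHS]/(- strict_lower_part (- A) i k) /strict_lower_part.
  by case: ifP => _; rewrite ?oppr0//; exact: opprK.
have -> : upper_part (- A) = - upper_part A.
  apply/funext => i; apply/funext => k.
  rewrite -[RHS]/(- upper_part A i k) /upper_part.
  by case: ifP => _; rewrite ?oppr0.
rewrite (sicommN_commute hr (band_upper_part hr) hj); last first.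
  by rewrite !(sipowD _ _ hLax) addnC.
by rewrite upper_partE opprB addrC subrK.
Qed.

End Factorization.

Theorem proposition33 (R : realType) (N : nat) (W : measure_matrix R N)
    (D : set (times R)) (S1 S2 : times R -> simx R)
    (domainD : time_domain D)
    (defined : forall t, D t -> deformation_defined (moment_matrix W) t)
    (derivable_termwise : forall t, D t ->
       deformation_termwise_derivable (moment_matrix W) t)
    (S1_lower : forall t, D t -> lower_unitriangular (S1 t))
    (S2_upper : forall t, D t ->
       upper_triangular (S2 t) /\ siinvertible (S2 t))
    (factorization : forall t, D t ->
       deformation (moment_matrix W) t = simul (siinv (S1 t)) (S2 t)) :
  let L1 := fun t => Lax1 (S1 t) in
  let L2 := fun t => Lax2 (S2 t) in
  forall t, D t -> forall j r : nat, (0 < j)%N -> (0 < r)%N ->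
  [/\ is_partial1 r (fun s => sipow (L1 s) j) t
        (sicomm (upper_part (sipow (L1 t) r)) (sipow (L1 t) j)),
      is_partial2 r (fun s => sipow (L1 s) j) t
        (sicomm (strict_lower_part (sipow (L2 t) r)) (sipow (L1 t) j)),
      is_partial1 r (fun s => sipow (L2 s) j) t
        (sicomm (upper_part (sipow (L1 t) r)) (sipow (L2 t) j)) &
      is_partial2 r (fun s => sipow (L2 s) j) t
        (sicomm (strict_lower_part (sipow (L2 t) r)) (sipow (L2 t) j))].
Proof.
move=> L1 L2 t Dt j r _ r0.
have [t10 t20 /(_ r r0)[near1 near2]] := domainD t Dt.
have [term1 term2] := derivable_termwise t Dt r r0.
pose G := deformation (moment_matrix W).
have factors s : D s -> [/\ lower_unitriangular (S1 s), upper_triangular (S2 s),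
    siinvertible (S2 s) & G s = simul (siinv (S1 s)) (S2 s)].
  move=> Ds; have [] := S2_upper s Ds.
  by split; [exact: S1_lower| | |exact: factorization].
have dG1 := deformation_derive1 r0 t10 (defined t Dt) term1.
have dG2 := deformation_derive2 r0 t20 (defined t Dt) term2.
have hS1 := @filterS _ _ (nbhs_filter _) _ _
  (fun y => factors (set_t1 t r y)) near1.
have hS2 := @filterS _ _ (nbhs_filter _) _ _
  (fun y => factors (set_t2 t r y)) near2.
have [] := @Lax_flow1 R (t.1 r) (fun y => G (set_t1 t r y))
  (fun y => S1 (set_t1 t r y)) (fun y => S2 (set_t1 t r y)) hS1 r j.
  by rewrite set_t1_id.
have [] := @Lax_flow2 R (t.2 r) (fun y => G (set_t2 t r y))
  (fun y => S1 (set_t2 t r y)) (fun y => S2 (set_t2 t r y)) hS2 r j.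
  by rewrite set_t2_id.
rewrite set_t1_id set_t2_id => flow21 flow22 flow11 flow12.
by split; [exact: flow11 | exact: flow21 | exact: flow12 | exact: flow22].
Qed.
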